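(* Let $d\ge 1$ be an integer, let $A\subseteq\mathbb{R}^d$, let $0<\delta\le d$, and let $\rho_0>0$ and $\vec\beta=(\beta_i)_{i\in\mathbb{N}}$ be admissible game parameters (as defined in the context). If player II has a winning strategy in the $\delta$-Hausdorff dimension game $G^{\delta}_{\vec\beta}(A)$ with target set $A$, then $\mathrm{HD}(A)\le\delta$.
   Context: $\mathrm{HD}$ denotes Hausdorff dimension of subsets of $\mathbb{R}^d$ (Euclidean metric), defined for arbitrary subsets. $B(x,r)$ denotes the closed ball of radius $r$ centred at $x$. A set is $r$-separated if any two distinct points of it are at distance at least $r$. $|F|$ is the cardinality of a finite set $F$. Admissible game parameters: a real $\rho_0>0$ and a sequence $(\beta_i)_{i\in\mathbb{N}}$ of reals with $0<\beta_{i+1}\le\beta_i<\frac12$ for all $i$, $\lim_{i\to\infty}\beta_i=0$, and $$\forall\eta>0\ \exists n_0\ \forall n\ge n_0\quad \beta_n\ge\prod_{i<n}\beta_i^{\eta}.$$ Put $\rho_n=\left(\prod_{i<n}\beta_i\right)\rho_0$. The $\delta$-Hausdorff dimension game $G^{\delta}_{\vec\beta}(A)$ ($A\subseteq\mathbb{R}^d$, $0<\delta\le d$): players I and II alternate moves $F_0,x_0,F_1,x_1,F_2,x_2,\dots$, where I plays the $F_i$ and II plays the $x_i$. Player I must follow these rules: (a) each $F_i$ is a finite nonempty set of points of $\mathbb{Q}^d$; (b) each $F_i$ is $3\rho_i$-separated; (c) $F_{i+1}\subseteq B(x_i,(1-\beta_i)\rho_i)$ for all $i$; (d) there is some $c>0$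 such that $\displaystyle\limsup_{n\to\infty}\frac{\prod_{i<n}|F_i|^{-1}}{\prod_{i<n}\beta_i^{\delta}}\le c$. Player II must play $x_i\in F_i$ for every $i$. A player who violates these requirements loses (the first to violate (a), (b), (c) or II's requirement loses; if only (d) is violated, I loses). If the players meet these requirements, player I wins if and only if $\lim_{n\to\infty}x_n\in A$; otherwise II wins. *)

(* Defs.v *)
From mathcomp Require Import all_boot all_order all_algebra finmap.
From mathcomp Require Import all_classical all_reals all_analysis.

Set Implicit Arguments.
Unset Strict Implicit.
Unset Printing Implicit Defensive.

Import Order.TTheory GRing.Theory Num.Theory.
Import numFieldTopology.Exports numFieldNormedType.Exports.

Local Open Scope classical_set_scope.
Local Open Scope ring_scope.

(* The norm that the library puts on 'rV[R]_d is the sup norm, so the Euclidean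
   metric is defined here. *)
Definition enorm (R : realType) (d : nat) (x : 'rV[R]_d) : R :=
  Num.sqrt (\sum_(i < d) x ord0 i ^+ 2).

Definition eball (R : realType) (d : nat) (x : 'rV[R]_d) (r : R) :
    set 'rV[R]_d :=
  [set y | enorm (y - x) <= r].

(* The diameter of set0 is -oo. *)
Definition ediam (R : realType) (d : nat) (U : set 'rV[R]_d) : \bar R :=
  ereal_sup [set (enorm (p.1 - p.2))%:E | p in U `*` U].

(* diam(U)^s, with the conventions 0^0 = 1 and diam(set0)^s = 0 for every s. *)
Definition hausdorff_gauge (R : realType) (d : nat) (s : R)
    (U : set 'rV[R]_d) : \bar R :=
  if `[< U = set0 >] then 0%E else poweR (ediam U) s.

Definition hausdorff_premeasure (R : realType) (d : nat) (s eps : R)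
    (A : set 'rV[R]_d) : \bar R :=
  ereal_inf [set (\sum_(0 <= i <oo) hausdorff_gauge s (U i))%E |
    U in [set U : nat -> set 'rV[R]_d |
      A `<=` \bigcup_i U i /\ forall i, (ediam (U i) <= eps%:E)%E]].

Definition hausdorff_measure (R : realType) (d : nat) (s : R)
    (A : set 'rV[R]_d) : \bar R :=
  ereal_sup [set hausdorff_premeasure s eps A | eps in [set eps | 0 < eps]].

Definition hausdorff_dim (R : realType) (d : nat) (A : set 'rV[R]_d) :
    \bar R :=
  ereal_inf [set s%:E | s in [set s : R |
    0 <= s /\ hausdorff_measure s A = 0%E]].

Definition admissible (R : realType) (rho0 : R) (beta : nat -> R) : Prop :=
  [/\ 0 < rho0,
      forall i, [/\ 0 < beta i.+1, beta i.+1 <= beta i & beta i < 2^-1],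
      beta i @[i --> \oo] --> (0 : R) &
      forall eta : R, 0 < eta ->
        exists n0 : nat, forall n : nat, (n0 <= n)%N ->
          \prod_(i < n) (beta i `^ eta) <= beta n].

Definition game_radius (R : realType) (rho0 : R) (beta : nat -> R) (n : nat) :
    R :=
  (\prod_(i < n) beta i) * rho0.

Definition rat_point (R : realType) (d : nat) (q : 'rV[rat]_d) : 'rV[R]_d :=
  map_mx ratr q.

Definition rat_separated (R : realType) (d : nat) (r : R)
    (F : {fset 'rV[rat]_d}) : Prop :=
  forall p q : 'rV[rat]_d, p \in F -> q \in F -> p != q ->
    r <= enorm (rat_point R p - rat_point R q).

(* Rules (a), (b), (c) for the n-th move of player I in the run
   F 0, x 0, F 1, x 1, ...  That F n is a finite subset of Q^d is part of its
   type. *)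
Definition legalI (R : realType) (d : nat) (rho0 : R) (beta : nat -> R)
    (F : nat -> {fset 'rV[rat]_d}) (x : nat -> 'rV[rat]_d) (n : nat) : Prop :=
  [/\ F n != fset0,
      rat_separated (3 * game_radius rho0 beta n) (F n) &
      forall m : nat, n = m.+1 -> forall q, q \in F n ->
        eball (rat_point R (x m)) ((1 - beta m) * game_radius rho0 beta m)
          (rat_point R q)].

Definition legalII (d : nat) (F : nat -> {fset 'rV[rat]_d})
    (x : nat -> 'rV[rat]_d) (n : nat) : Prop :=
  x n \in F n.

(* Rule (d). *)
Definition growth_rule (R : realType) (d : nat) (delta : R) (beta : nat -> R)
    (F : nat -> {fset 'rV[rat]_d}) : Prop :=
  exists2 c : R, 0 < c &
    (limn_esup (fun n : nat =>
       ((\prod_(i < n) (#|` F i|%:R : R)^-1)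
          / (\prod_(i < n) (beta i `^ delta)))%:E) <= c%:E)%E.

(* The limit is taken for the library's topology on 'rV[R]_d, which is the
   topology of the Euclidean norm. *)
Definition limit_in (R : realType) (d : nat) (A : set 'rV[R]_d)
    (x : nat -> 'rV[rat]_d) : Prop :=
  exists2 l : 'rV[R]_d, rat_point R (x n) @[n --> \oo] --> l & A l.

(* Either player I is the first to break a rule, or nobody breaks (a), (b), (c)
   or the rule for II, and then (d) fails or the limit is not in A. *)
Definition winsII (R : realType) (d : nat) (A : set 'rV[R]_d)
    (delta rho0 : R) (beta : nat -> R)
    (F : nat -> {fset 'rV[rat]_d}) (x : nat -> 'rV[rat]_d) : Prop :=
  (exists2 n : nat, ~ legalI rho0 beta F x n &
     forall m : nat, (m < n)%N -> legalI rho0 beta F x m /\ legalII F x m)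
  \/ ((forall n : nat, legalI rho0 beta F x n /\ legalII F x n) /\
      (~ growth_rule delta beta F \/ ~ limit_in A x)).

(* A strategy for II maps the moves [:: F 0; ...; F n] made so far by I to the
   answer x n; the earlier moves of II are determined by the strategy. *)
Definition winning_strategyII (R : realType) (d : nat) (A : set 'rV[R]_d)
    (delta rho0 : R) (beta : nat -> R)
    (tau : seq {fset 'rV[rat]_d} -> 'rV[rat]_d) : Prop :=
  forall F : nat -> {fset 'rV[rat]_d},
    winsII A delta rho0 beta F (fun n : nat => tau (mkseq F n.+1)).

(* Main.v *)
Require Import Defs.
From mathcomp Require Import all_boot all_order all_algebra finmap.
From mathcomp Require Import all_classical all_reals all_analysis.
From mathcomp Require Import ring lra.

(** Let II have a winning strategy [tau].  The proof of [HD A <= delta] is a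
    count of the runs that player I can force.

    Let I be able to play the points of a finite set [E], and let I offer to
    [tau] first all of [E], then [E] without the answer of [tau], and so on.
    Each point of [E] is the answer to one of these moves, and the moves have
    the sizes [1, 2, ..., #|E|], each once ([answers_by_size]).  Doing this with
    each of boundedly many colour classes of a lattice, whose points together
    come within [rho_(n+1) / 4] of every point close to the last answer, gives a
    tree of legal histories.  Its branches are labelled by naturals, a label [k]
    stands for a move of at least [(k + 1) / K] points, where [K] depends only
    on [d], and every point close to the opening move has an infinite branch
    whose answers stay within [rho_n / 4] of it ([answer_family],
    [exists_moves]).

    A point of [A] is therefore the limit of a run against [tau].  Since II
    wins the run, the moves of I break the growth rule: for infinitely many [N],
    the product of the sizes of the moves is less than
    [(beta_0 ... beta_N)^-delta] ([few_points_infinitely_often]).  A tree whose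
    branches have sizes [1, 2, 3, ...] has few vertices with a small product of
    sizes: at depth [N] at most [M^a C^N] of them have a product at most [M],
    where [a > 1] is arbitrary and [C] is a multiple of the sum of
    [(k + 1)^-a].  This is [hcontent_path_balls], stated for the content of the
    union of the balls around these vertices.  For [s > delta], admissibility of
    [beta] absorbs both the ratio [beta_N] that is missing from [rho_N] and the
    factor [C^N], so that the cost of depth [N] is [O(2^-N)]
    ([path_cost_geometric]).  As every point of [A] near a given opening move is
    covered at infinitely many depths, the [s]-dimensional content of this part
    of [A] vanishes ([hcontent_limsup_null]), and there are countably many
    opening moves. *)

Set Implicit Arguments.
Unset Strict Implicit.
Unset Printing Implicit Defensive.

Import Order.TTheory GRing.Theory Num.Theory.
Import numFieldTopology.Exports numFieldNormedType.Exports.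

Local Open Scope classical_set_scope.
Local Open Scope ring_scope.

(** * Euclidean norm *)

Section EuclideanNorm.
Context (R : realType) (d : nat).
Implicit Types (u v x y c : 'rV[R]_d).

Lemma enorm_ge0 x : 0 <= enorm x.
Proof. exact: sqrtr_ge0. Qed.

Lemma enorm_sqr x : enorm x ^+ 2 = \sum_(i < d) x ord0 i ^+ 2.
Proof. by rewrite sqr_sqrtr// sumr_ge0// => i _; rewrite sqr_ge0. Qed.

Lemma enormN x : enorm (- x) = enorm x.
Proof. by congr Num.sqrt; apply: eq_bigr => i _; rewrite mxE sqrrN. Qed.

Lemma enormB x y : enorm (x - y) = enorm (y - x).
Proof. by rewrite -enormN opprB. Qed.

Lemma coordB x y i : (x - y) ord0 i = x ord0 i - y ord0 i.
Proof. by rewrite !mxE. Qed.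

Lemma coord_le_enorm x i : `|x ord0 i| <= enorm x.
Proof.
rewrite -[leLHS]ger0_norm// -ler_sqr ?nnegrE ?enorm_ge0// ?normr_ge0//.
rewrite normr_id real_normK ?num_real// enorm_sqr (bigD1 i)//= lerDl.
by rewrite sumr_ge0// => j _; rewrite sqr_ge0.
Qed.

Lemma enorm_le_coord x (a : R) :
  (forall i, `|x ord0 i| <= a) -> 0 <= a -> enorm x <= d%:R * a.
Proof.
move=> xa a0; rewrite -ler_sqr ?nnegrE ?enorm_ge0 ?mulr_ge0// enorm_sqr.
apply: (@le_trans _ _ (\sum_(i < d) a ^+ 2)).
  by apply: ler_sum => i _; rewrite -real_normK ?num_real// ler_sqr ?nnegrE.
rewrite sumr_const card_ord exprMn -[leLHS]mulr_natl ler_wpM2r ?sqr_ge0//.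
by rewrite -natrX ler_nat; case: (d) => // n; rewrite expnS expn1 leq_pmulr.
Qed.

(** This weak form of the triangle inequality loses a constant but follows from
    [(a + b)^2 <= 2 (a^2 + b^2)] in each coordinate; the constants of the game
    leave enough room for it. *)
Lemma enormD_sqr u v :
  enorm (u + v) ^+ 2 <= 2 * (enorm u ^+ 2 + enorm v ^+ 2).
Proof.
rewrite !enorm_sqr -big_split mulr_sumr; apply: ler_sum => i _ /=.
rewrite mxE -subr_ge0.
by rewrite [leRHS](_ : _ = (u ord0 i - v ord0 i) ^+ 2) ?sqr_ge0//; ring.
Qed.

Lemma ediam_eball_le c (r : R) (U : set 'rV[R]_d) :
  0 <= r -> U `<=` eball c r -> (ediam U <= (2 * r)%:E)%E.
Proof.
move=> r0 Uc; apply: ge_ereal_sup => _ [[x y] [/= Ux Uy] <-].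
rewrite lee_fin -ler_sqr ?nnegrE ?enorm_ge0 ?mulr_ge0//.
have -> : x - y = (x - c) + (c - y) by rewrite addrA subrK.
apply: (le_trans (enormD_sqr _ _)).
have := Uc _ Ux; have := Uc _ Uy; rewrite /eball/= (enormB c) => h1 h2.
have : enorm (x - c) ^+ 2 <= r ^+ 2 by rewrite ler_sqr ?nnegrE ?enorm_ge0.
have : enorm (y - c) ^+ 2 <= r ^+ 2 by rewrite ler_sqr ?nnegrE ?enorm_ge0.
rewrite exprMn; lra.
Qed.

Lemma ediam_ge0 (U : set 'rV[R]_d) : U !=set0 -> (0 <= ediam U)%E.
Proof.
move=> [x Ux]; apply: ereal_sup_ubound; exists (x, x) => //=.
rewrite subrr; congr EFin; rewrite /enorm big1 ?sqrtr0// => i _.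
by rewrite mxE expr0n.
Qed.

Lemma hausdorff_gauge_ge0 (s : R) (U : set 'rV[R]_d) :
  (0 <= hausdorff_gauge s U)%E.
Proof. by rewrite /hausdorff_gauge; case: ifP => // _; exact: poweR_ge0. Qed.

Lemma hausdorff_gauge_eball_le (s : R) c (r : R) (U : set 'rV[R]_d) :
  0 <= s -> 0 <= r -> U `<=` eball c r ->
  (hausdorff_gauge s U <= ((2 * r) `^ s)%:E)%E.
Proof.
move=> s0 r0 Uc; rewrite /hausdorff_gauge; case: ifPn => [_|/asboolP/eqP].
  by rewrite lee_fin powR_ge0.
move=> /set0P/ediam_ge0 U0; rewrite -poweR_EFin.
have r20 : (0 <= (2 * r)%:E)%E by rewrite lee_fin mulr_ge0.
apply: gt0_ler_poweR => //; rewrite ?in_itv/= ?U0 ?r20 ?leey//.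
exact: (ediam_eball_le r0 Uc).
Qed.

Lemma rat_point_dense (x : 'rV[R]_d) (e : R) : 0 < e ->
  exists q : 'rV[rat]_d, eball (rat_point R q) e x.
Proof.
move=> e0.
have e'0 : 0 < e / d.+1%:R by rewrite divr_gt0.
have /choice[f fP] i : exists q : rat,
    ratr q \in `]x ord0 i, x ord0 i + e / d.+1%:R[.
  by apply: rat_in_itvoo; rewrite ltrDl.
exists (\row_i f i); rewrite /eball/=.
apply: (@le_trans _ _ (d%:R * (e / d.+1%:R))).
  apply: enorm_le_coord; last exact: ltW.
  move=> i; rewrite !mxE; have := fP i; rewrite in_itv/= => /andP[h1 h2].
  by rewrite ltr0_norm ?subr_lt0// opprB lerBlDl ltW.
rewrite mulrCA ger_pMr// ler_pdivrMr ?mul1r ?ltr0n// ler_nat.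
exact: leqnSn.
Qed.

End EuclideanNorm.

(** * Hausdorff premeasures as outer measures *)

Section Content.
Context (R : realType) (d : nat).
Implicit Types (s eps : R) (U X : set 'rV[R]_d).

Definition small_gauge s eps U : \bar R :=
  if `[< (ediam U <= eps%:E)%E >] then hausdorff_gauge s U else +oo%E.

(** With the constraint on the diameters moved into the gauge, the Hausdorff
    premeasure is the outer measure induced by a function on sets, hence
    countably subadditive.  Covers by arbitrary sets are allowed because the
    sigma-algebra is that of all sets. *)
Definition hcontent s eps : set 'rV[R]_d -> \bar R :=
  @mu_ext _ (g_sigma_algebraType [set: set 'rV[R]_d]) R (small_gauge s eps).

Lemma ediam0 : ediam (@set0 'rV[R]_d) = -oo%E.
Proof. by rewrite /ediam setX0 image_set0 ereal_sup0. Qed.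

Lemma small_gauge0 s eps : small_gauge s eps set0 = 0%E.
Proof.
rewrite /small_gauge ediam0 asboolT ?leNye// /hausdorff_gauge.
by case: asboolP.
Qed.

Lemma small_gauge_ge0 s eps U : (0 <= small_gauge s eps U)%E.
Proof.
by rewrite /small_gauge; case: ifP => // _; exact: hausdorff_gauge_ge0.
Qed.

Lemma measurable_all (U : set 'rV[R]_d) :
  measurable (U : set (g_sigma_algebraType [set: set 'rV[R]_d])).
Proof. exact: sub_sigma_algebra. Qed.

Lemma hcontent_ge0 s eps X : (0 <= hcontent s eps X)%E.
Proof. apply: mu_ext_ge0 => U; exact: small_gauge_ge0. Qed.

Lemma hcontent_subset s eps X U :
  X `<=` U -> (hcontent s eps X <= hcontent s eps U)%E.
Proof.
exact: (@le_mu_ext _ (g_sigma_algebraType [set: set 'rV[R]_d])).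
Qed.

Lemma hcontent0 s eps : hcontent s eps set0 = 0%E.
Proof.
apply: mu_ext0; first exact: small_gauge0.
exact: small_gauge_ge0.
Qed.

Lemma hcontent_bigcup s eps X (F : nat -> set 'rV[R]_d) :
  X `<=` \bigcup_i F i ->
  (hcontent s eps X <= \sum_(i <oo) hcontent s eps (F i))%E.
Proof.
move=> XF; apply: le_trans (hcontent_subset s eps XF) _.
apply: mu_ext_sigma_subadditive; exact: small_gauge_ge0.
Qed.

Lemma hcontent_eball s eps c r X : 0 <= s -> 0 <= r -> 2 * r <= eps ->
  X `<=` eball c r -> (hcontent s eps X <= ((2 * r) `^ s)%:E)%E.
Proof.
move=> s0 r0 reps Xc.
apply: le_trans (hausdorff_gauge_eball_le s0 r0 Xc).
pose F (i : nat) : set 'rV[R]_d := if i == 0%N then X else set0.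
apply: (@le_trans _ _ (\sum_(i <oo) small_gauge s eps (F i))%E).
  apply: ereal_inf_lbound; exists F => //.
  by split=> [i|x Xx]; [exact: measurable_all|exists 0%N].
rewrite (@nneseries_recl _ predT)//; last first.
  by move=> ? _; exact: small_gauge_ge0.
rewrite eseries0/= => [|[]//i _ _]; last exact: small_gauge0.
rewrite adde0 /small_gauge asboolT//.
by apply: le_trans (ediam_eball_le r0 Xc) _; rewrite lee_fin.
Qed.

Lemma hausdorff_premeasure_le_hcontent s eps X :
  (hausdorff_premeasure s eps X <= hcontent s eps X)%E.
Proof.
apply: le_ereal_inf_tmp => _ [F [_ XF] <-].
have [small|] := pselect (forall i, (ediam (F i) <= eps%:E)%E).
  apply: ereal_inf_lbound; exists F; first by split.
  by apply: eq_eseriesr => i _; rewrite /small_gauge asboolT.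
move=> /existsNP[i large].
rewrite (@eseries_pinfty _ (fun i => small_gauge s eps (F i)) xpredT i) ?leey//.
- by move=> j _; rewrite gt_eqF// (lt_le_trans _ (small_gauge_ge0 _ _ _)).
- by rewrite /small_gauge asboolF.
Qed.

Lemma hausdorff_dim_le (A : set 'rV[R]_d) (delta : R) : 0 <= delta ->
  (forall s eps, delta < s -> 0 < eps -> hcontent s eps A = 0%E) ->
  (hausdorff_dim A <= delta%:E)%E.
Proof.
move=> delta0 A0; apply/lee_addgt0Pr => e e0.
apply: ereal_inf_lbound; exists (delta + e) => //.
split; first by rewrite addr_ge0// ltW.
have P0 eps : 0 < eps -> hausdorff_premeasure (delta + e) eps A = 0%E.
  move=> eps0; apply/eqP; rewrite eq_le; apply/andP; split.
    by rewrite -(A0 (delta + e) eps) ?ltrDl// hausdorff_premeasure_le_hcontent.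
  apply: le_ereal_inf_tmp => _ [U _ <-]; apply: nneseries_ge0 => i _ _.
  exact: hausdorff_gauge_ge0.
apply/eqP; rewrite eq_le; apply/andP; split.
  by apply: ge_ereal_sup => _ [eps eps0 <-]; rewrite P0.
by apply: ereal_sup_ubound; exists 1 => //=; exact: P0.
Qed.

End Content.

(** * Counting paths in a countably branching tree *)

Section Counting.
Context (R : realType).

(** Write [S n] for the partial sum.  The even terms of [S (2 n)] add up to
    [2^-a S n], and each odd term but the first is at most the even term before
    it, so [S n <= 1 + 2^(1-a) S n]. *)
Lemma pseries_bounded (a : R) : 1 < a -> exists2 C : R, 0 < C &
  forall n, \sum_(k < n) k.+1%:R `^ (- a) <= C.
Proof.
move=> a1; set f := fun k : nat => (k.+1%:R : R) `^ (- a).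
pose S n := \sum_(k < n) f k; pose q : R := 2 `^ (- a).
have f0 k : 0 <= f k by exact: powR_ge0.
have fdouble k : f k.*2.+1 = q * f k.
  by rewrite /f /q -powRM// -natrM mul2n -doubleS.
have fdecr k : f k.+1 <= f k.
  rewrite /f !powRN lef_pV2 ?posrE ?powR_gt0//.
  by rewrite ge0_ler_powR ?nnegrE ?ler_nat// ltW// (lt_trans ltr01).
have Sdouble n : S n.*2.+1 <= 1 + 2 * q * S n.
  elim: n => [|n IHn].
    by rewrite /S big_ord_recr !big_ord0/= add0r mulr0 addr0 /f powR1.
  rewrite doubleS /S 2!big_ord_recr/= -/(S _) big_ord_recr/= -/(S n).
  have := fdecr n.*2.+1; rewrite fdouble.
  move: IHn; rewrite mulrDr -!mulrA; move: (q * S n) (q * f n) => x y; lra.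
have Sincr n m : (n <= m)%N -> S n <= S m.
  move=> nm; rewrite /S -!(big_mkord xpredT f) (big_cat_nat (leq0n n) nm)//=.
  by rewrite lerDl sumr_ge0.
have q1 : 2 * q < 1.
  rewrite -[X in X * _](@powRr1 _ 2)// /q -powRD ?pnatr_eq0 ?implybT//.
  rewrite -opprB powRN invf_lt1 ?powR_gt0//.
  rewrite -[ltLHS](congr1 (@^~ (a - 1)) (powR1 R)).
  by rewrite gt0_ltr_powR ?nnegrE ?subr_gt0// ltr1n.
exists (1 - 2 * q)^-1 => [|n]; first by rewrite invr_gt0 subr_gt0.
rewrite -/(S n) -[leRHS]mul1r ler_pdivlMr ?subr_gt0//.
have : S n <= S n.*2.+1 by apply: Sincr; rewrite leqW// -addnn leq_addr.
by have := Sdouble n; lra.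
Qed.

Lemma nneseries_le (u : nat -> R) (C : R) : (forall k, 0 <= u k) ->
  (forall n, \sum_(k < n) u k <= C) -> (\sum_(k <oo) (u k)%:E <= C%:E)%E.
Proof.
move=> u0 uC; apply: lime_le.
  by apply: is_cvg_nneseries => k _ _; rewrite lee_fin.
by apply: nearW => n; rewrite big_mkord sumEFin lee_fin.
Qed.

Context (d : nat) (H : Type) (step : H -> nat -> H) (centre : H -> 'rV[R]_d).

(** With [K] colours, a lower bound for the product of the sizes of the moves
    along a path. *)
Definition path_weight (K : nat) (p : seq nat) : R :=
  \prod_(k <- p) (k.+1%:R / K%:R).

Definition path_balls (K : nat) (r : R) (N : nat) (h : H) (M : R) :
    set 'rV[R]_d :=
  [set x | exists p : seq nat,
    [/\ size p = N, path_weight K p <= M &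
        eball (centre (foldl step h p)) r x]].

(** Among the infinitely many paths of length [N], those of weight at most [M]
    number at most [M^a C^N], by induction on the first label [k], after which
    the remaining weight is at most [M K / (k + 1)]. *)
Lemma hcontent_path_balls (s eps r a C : R) (K : nat) :
  0 <= s -> 0 <= r -> 2 * r <= eps -> (0 < K)%N -> 0 <= a -> 0 <= C ->
  (forall n, \sum_(k < n) (K%:R / k.+1%:R) `^ a <= C) ->
  forall N h M, 0 < M ->
  (hcontent s eps (path_balls K r N h M)
     <= (C ^+ N * M `^ a * (2 * r) `^ s)%:E)%E.
Proof.
move=> s0 r0 reps K0 a0 C0 KC; elim=> [|N IHN] h M M0.
  have [M1|M1] := leP 1 M; last first.
    have -> : path_balls K r 0 h M = set0.
      apply/seteqP; split=> // x [p [/size0nil -> + _]].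
      by rewrite /path_weight big_nil leNgt M1.
    by rewrite hcontent0 lee_fin !mulr_ge0// ?powR_ge0.
  apply: (@le_trans _ _ ((2 * r) `^ s)%:E).
    apply: (hcontent_eball (c := centre h)) => // x [p [/size0nil -> _]].
    exact.
  rewrite lee_fin expr0 mul1r ler_peMl ?powR_ge0//.
  by rewrite -[leLHS](congr1 (@^~ a) (powR1 R)) ge0_ler_powR// nnegrE ltW.
pose M' k := M * (K%:R / k.+1%:R).
have M'0 k : 0 < M' k by rewrite mulr_gt0// divr_gt0// ltr0n.
apply: le_trans (hcontent_bigcup s eps
  (F := fun k => path_balls K r N (step h k) (M' k)) _) _.
  move=> x [[|k p] []// [sp] + xp].
  rewrite /path_weight big_cons => pM; exists k => //; exists p; split => //.
  by rewrite /M' -ler_pdivrMr ?divr_gt0 ?ltr0n// invf_div mulrC.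
pose u k := C ^+ N * M' k `^ a * (2 * r) `^ s.
have u0 k : 0 <= u k by rewrite !mulr_ge0// ?powR_ge0// exprn_ge0.
apply: (@le_trans _ _ (\sum_(k <oo) (u k)%:E)%E).
  by apply: lee_nneseries => k *; [exact: hcontent_ge0|exact: IHN].
apply: nneseries_le => // n.
rewrite -mulr_suml ler_wpM2r ?powR_ge0//.
rewrite -mulr_sumr exprSr -!mulrA ler_wpM2l ?exprn_ge0//.
under eq_bigr do rewrite /M' powRM ?(ltW M0) ?divr_ge0//.
by rewrite -mulr_sumr mulrC ler_wpM2r ?powR_ge0.
Qed.

End Counting.

(** * Moves whose answers reach every point *)

Section Answers.
Local Open Scope fset_scope.

(** Remove the answers to [E], to [E] without that answer, and so on, until
    nothing is left; the move of size [r] is the one made when [r] points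
    remain. *)
Lemma answers_by_size (T : choiceType) (t : {fset T} -> T) (E : {fset T}) :
  (forall F, F `<=` E -> F != fset0 -> t F \in F) ->
  exists G : nat -> {fset T}, forall z, z \in E ->
    exists2 r, (0 < r)%N & [/\ G r `<=` E, #|` G r| = r & t (G r) = z].
Proof.
have [n] := ubnP #|` E|; elim: n E => // n IHn E En tE.
have [->|E0] := eqVneq E fset0; first by exists (fun=> fset0).
have tEE : t E \in E by exact: tE.
have cE : #|` E| = #|` E `\ t E|.+1 by rewrite (cardfsD1 (t E)) tEE.
have [|F FE F0|G GP] := IHn (E `\ t E); first by rewrite -ltnS -cE.
  by apply: tE => //; apply: fsubset_trans FE (fsubD1set _ _).
exists (fun r => if r == #|` E| then E else G r) => z zE.
have [->|zt] := eqVneq z (t E).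
  by exists #|` E|; rewrite ?eqxx// cE.
have [|r r0 [GE cG tG]] := GP z; first by rewrite !inE zt.
exists r => //; rewrite ifN; last first.
  by rewrite -cG neq_ltn cE ltnS fsubset_leq_card.
by split=> //; apply: fsubset_trans GE (fsubD1set _ _).
Qed.

End Answers.

Lemma eqmod_leq_add (L m n : nat) : (m < n)%N -> m = n %[mod L] ->
  (m + L <= n)%N.
Proof.
move=> mn /esym/eqP; rewrite eqn_mod_dvd ?(ltnW mn)// => /dvdn_leq.
by rewrite subn_gt0 => /(_ mn); rewrite leq_subRL // ltnW.
Qed.

(** In a lattice of mesh at least [r / (8 d)], two points whose indices are
    congruent modulo [24 d] are at distance at least [3 r].  The residues colour
    the lattice, and the points of one colour are far enough apart to be played
    in one move. *)
Definition ncolours (d : nat) : nat := #|{ffun 'I_d -> 'I_(24 * d).-1.+1}|.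

Lemma ncolours_gt0 d : (0 < ncolours d)%N.
Proof. by apply/card_gt0P; exists [ffun=> ord0]. Qed.

Section Lattice.
Context (R : realType) (d : nat).
Local Notation colours := {ffun 'I_d -> 'I_(24 * d).-1.+1}.

(** A single [3 b rho]-separated set cannot come within [b rho / 4] of every
    point of a ball, whereas the colour classes of a lattice together do.  The
    radius [rho / 4] leaves room for the lattice points next to the smaller ball
    inside the ball of radius [(1 - b) rho]. *)
Lemma lattice_families (c : 'rV[rat]_d) (rho b : R) :
  (0 < d)%N -> 0 < rho -> 0 < b -> b < 2^-1 ->
  exists E : colours -> {fset 'rV[rat]_d},
  [/\ forall v, rat_separated (3 * (b * rho)) (E v),
      forall v q, q \in E v ->
        eball (rat_point R c) ((1 - b) * rho) (rat_point R q) &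
      forall x, eball (rat_point R c) (rho / 4) x ->
        exists v, exists2 q, q \in E v & eball (rat_point R q) (b * rho / 4) x].
Proof.
move=> d0 rho0 b0 b12.
have dR0 : 0 < d%:R :> R by rewrite ltr0n.
have L24 : ((24 * d).-1.+1 = 24 * d)%N by rewrite prednK// muln_gt0.
set L := (24 * d).-1.+1 in L24 *.
have br0 : 0 < b * rho by exact: mulr_gt0.
have [h] : exists h : rat,
    ratr h \in `]b * rho / (8 * d%:R), b * rho / (4 * d%:R)[.
  apply: rat_in_itvoo; rewrite ltr_pM2l// ltf_pV2 ?posrE ?mulr_gt0//.
  by rewrite ltr_pM2r// ltr_nat.
rewrite in_itv/= => /andP[]; rewrite ltr_pdivrMr ?mulr_gt0// => hlb.
rewrite ltr_pdivlMr ?mulr_gt0// => hub.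
have [hR hRE] : exists r : R, r = ratr h by exists (ratr h).
rewrite -hRE in hlb hub.
have h0 : 0 < hR by move: (lt_trans br0 hlb); rewrite pmulr_lgt0 ?mulr_gt0.
(* The lattice is cut to [2 M] steps in each direction around [c], enough to
   contain the lattice points next to the ball of radius [rho / 4]. *)
pose M := (Num.truncn (rho / hR)).+1.
have Mub : rho / hR < M%:R by rewrite truncnS_gt ?divr_ge0 ?ltW.
pose pt (j : {ffun 'I_d -> 'I_(M + M)}) : 'rV[rat]_d :=
  \row_i (c ord0 i + h * ((j i)%:R - M%:R)).
have ptE j i : rat_point R (pt j) ord0 i =
    ratr (c ord0 i) + hR * ((j i)%:R - M%:R).
  by rewrite !mxE rmorphD rmorphM rmorphB !rmorph_nat hRE.
pose good (v : colours) (j : {ffun 'I_d -> 'I_(M + M)}) :=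
  [forall i, (j i %% L)%N == v i] &&
  `[< eball (rat_point R c) ((1 - b) * rho) (rat_point R (pt j)) >].
exists (fun v => [fset q in
  [seq pt j | j <- enum {: {ffun 'I_d -> 'I_(M + M)}} & good v j]]%fset).
split=> [v p q|v q|x xc].
- rewrite !inE => /mapP[j + ->] /mapP[k + ->].
  rewrite !mem_filter => /andP[/andP[/forallP jv _] _].
  move=> /andP[/andP[/forallP kv _] _] jk.
  have [i ji] : exists i, j i != k i.
    apply/existsP; apply: contraNT jk => /existsPn jk; apply/eqP; congr pt.
    by apply/ffunP => i; apply/eqP; rewrite -[_ == _]negbK jk.
  have Ljk : L%:R <= `|(j i)%:R - (k i)%:R| :> R.
    have jkL : j i = k i %[mod L] by rewrite (eqP (jv i)) (eqP (kv i)).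
    have [lt|lt|/val_inj/eqP] := ltngtP (j i) (k i); last by rewrite (negPf ji).
    + rewrite distrC ger0_norm ?subr_ge0 ?ler_nat 1?ltnW//.
      by rewrite lerBrDl -natrD ler_nat eqmod_leq_add.
    + rewrite ger0_norm ?subr_ge0 ?ler_nat 1?ltnW//.
      by rewrite lerBrDl -natrD ler_nat eqmod_leq_add.
  apply: le_trans (coord_le_enorm _ i).
  rewrite coordB !ptE.
  rewrite [X in `|X|](_ : _ = hR * ((j i)%:R - (k i)%:R)); last by ring.
  rewrite normrM (gtr0_norm h0).
  apply: le_trans (_ : hR * L%:R <= _); last by rewrite ler_wpM2l// ltW.
  rewrite L24 natrM; move: hlb; rewrite mulrC; lra.
- rewrite !inE => /mapP[j + ->].
  by rewrite mem_filter => /andP[/andP[_ /asboolP]].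
- pose y i := (x ord0 i - ratr (c ord0 i)) / hR.
  have yM i : `|y i| < M%:R.
    apply: le_lt_trans Mub; rewrite normrM normfV (gtr0_norm h0) ler_wpM2r//.
      by rewrite invr_ge0 ltW.
    have := coord_le_enorm (x - rat_point R c) i.
    rewrite !mxE => /le_trans; apply.
    by apply: (le_trans xc); rewrite ler_pdivrMr//; lra.
  have y0 i : (0 <= Num.floor (y i + M%:R))%R.
    by rewrite floor_ge0; have := yM i; rewrite ltr_norml => /andP[+ _]; lra.
  have ylt i : (`|Num.floor (y i + M%:R)| < M + M)%N.
    rewrite -ltz_nat gez0_abs// -(@ltr_int R) (le_lt_trans (floor_le _))//.
    rewrite -pmulrn natrD; have := yM i; rewrite ltr_norml => /andP[_]; lra.
  pose j : {ffun 'I_d -> 'I_(M + M)} := [ffun i => Ordinal (ylt i)].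
  have xj : enorm (x - rat_point R (pt j)) <= b * rho / 4.
    apply: (@le_trans _ _ (d%:R * hR)); last first.
      by rewrite ler_pdivlMr// mulrC mulrA mulrC ltW.
    apply: enorm_le_coord; last exact: ltW.
    move=> i; rewrite coordB ptE ffunE/=.
    rewrite natr_absz (ger0_norm (y0 i)).
    have -> : x ord0 i = ratr (c ord0 i) + hR * y i.
      by rewrite /y mulrCA mulfV ?gt_eqF// mulr1; ring.
    set f : R := (Num.floor _)%:~R.
    rewrite [X in `|X|](_ : _ = hR * (y i + M%:R - f)); last by ring.
    rewrite normrM (gtr0_norm h0) ger_pMr// ger0_norm ?subr_ge0 ?floor_le//.
    have := floorD1_gt (y i + M%:R); rewrite intrD -/f; lra.
  move: j xj => j xj.
  exists [ffun i => inord (j i %% L)], (pt j); last by rewrite /eball.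
  rewrite !inE; apply/mapP; exists j => //; rewrite mem_filter mem_enum andbT.
  apply/andP; split.
    by apply/forallP => i; rewrite ffunE inordK ?ltn_pmod.
  apply/asboolP; rewrite /eball/=.
  have -> : rat_point R (pt j) - rat_point R c
      = (rat_point R (pt j) - x) + (x - rat_point R c) by rewrite addrA subrK.
  rewrite -ler_sqr ?nnegrE ?enorm_ge0 ?mulr_ge0 ?(ltW rho0)//; last lra.
  apply: (le_trans (enormD_sqr _ _)).
  have : enorm (x - rat_point R c) ^+ 2 <= (rho / 4) ^+ 2.
    by rewrite ler_sqr ?nnegrE ?enorm_ge0 ?divr_ge0// ltW.
  have : enorm (x - rat_point R (pt j)) ^+ 2 <= (b * rho / 4) ^+ 2.
    by rewrite ler_sqr ?nnegrE ?enorm_ge0 ?divr_ge0// ltW.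
  rewrite (enormB _ x) => h1 h2.
  have br : (b * rho) ^+ 2 <= (2^-1 * rho) ^+ 2.
    by rewrite ler_sqr ?nnegrE ?ltW ?mulr_gt0// ltr_pM2r.
  have br' : (2^-1 * rho) ^+ 2 <= ((1 - b) * rho) ^+ 2.
    rewrite ler_sqr ?nnegrE ?mulr_ge0 ?ler_pM2r ?(ltW rho0)//; lra.
  apply: le_trans br'; move: h1 h2 br.
  rewrite !expr_div_n !exprMn; have := sqr_ge0 rho; lra.
Qed.

(** Moves of size [r] in each of the [K] colours are numbered so that the label
    [k] of a move of size [r] satisfies [k + 1 <= K r].  The bound on [k] by the
    size is all that the count of paths needs. *)
Lemma answer_family (t : {fset 'rV[rat]_d} -> 'rV[rat]_d) (c : 'rV[rat]_d)
    (rho b : R) :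
  (0 < d)%N -> 0 < rho -> 0 < b -> b < 2^-1 ->
  let legal (F : {fset 'rV[rat]_d}) :=
    [/\ F != fset0, rat_separated (3 * (b * rho)) F &
        forall q, q \in F ->
          eball (rat_point R c) ((1 - b) * rho) (rat_point R q)] in
  (forall F, legal F -> t F \in F) ->
  exists G : nat -> {fset 'rV[rat]_d}, forall x,
    eball (rat_point R c) (rho / 4) x ->
    exists k, [/\ legal (G k), (k < ncolours d * #|` G k|)%N &
                  eball (rat_point R (t (G k))) (b * rho / 4) x].
Proof.
move=> d0 rho0 b0 b12 legal tP.
have [E [Esep Eball Ecover]] := lattice_families c d0 rho0 b0 b12.
have legalE v F : (F `<=` E v)%fset -> F != fset0 -> legal F.
  move=> /fsubsetP FE F0; split=> // [p q pF qF|q qF].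
    by apply: Esep; exact: FE.
  exact/Eball/FE.
have /choice[G GP] v := answers_by_size
  (fun F FE F0 => tP F (@legalE v F FE F0)).
have K0 : (0 < #|colours|)%N := ncolours_gt0 d.
(* The label [k] encodes the size [k %/ K + 1] of the move and the colour of
   rank [k %% K], where [K] is the number of colours. *)
exists (fun k => G (enum_val (Ordinal (ltn_pmod k K0))) (k %/ #|colours|).+1).
move=> x /Ecover[v [q qE qx]]; have [[//|r] _ [GE Gr tG]] := GP v q qE.
exists (r * #|colours| + enum_rank v)%N.
have kE : G (enum_val (Ordinal (ltn_pmod (r * #|colours| + enum_rank v) K0)))
    ((r * #|colours| + enum_rank v) %/ #|colours|).+1 = G v r.+1.
  rewrite divnMDl// divn_small ?ltn_ord// addn0; congr (G _ _).
  rewrite -[RHS]enum_rankK; congr enum_val; apply: val_inj => /=.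
  by rewrite modnMDl modn_small.
rewrite kE tG Gr; split=> //.
  by apply: legalE GE _; rewrite -cardfs_gt0 Gr.
by rewrite /ncolours mulnS addnC (mulnC r) ltn_add2r ltn_ord.
Qed.

End Lattice.

(** * Admissible parameters *)

Section AdmissibleParameters.
Context (R : realType) (rho0 : R) (beta : nat -> R).
Hypothesis adm : admissible rho0 beta.
Local Notation rho := (game_radius rho0 beta).
Local Notation P n := (\prod_(i < n) beta i).

Lemma beta_gt0 i : 0 < beta i.
Proof. by have [_ /(_ i)[b1 bi _] _ _] := adm; exact: lt_le_trans bi. Qed.

Lemma beta_lt_half i : beta i < 2^-1.
Proof. by have [_ /(_ i)[]] := adm. Qed.

Lemma prod_beta_gt0 n : 0 < P n.
Proof. by apply: prodr_gt0 => i _; exact: beta_gt0. Qed.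

Lemma prod_powR_beta n (a : R) :
  \prod_(i < n) (beta i `^ a) = (P n) `^ a.
Proof.
elim: n => [|n IHn]; first by rewrite !big_ord0 powR1.
by rewrite !big_ord_recr/= IHn powRM ?ltW ?prod_beta_gt0 ?beta_gt0.
Qed.

Lemma game_radius_gt0 n : 0 < rho n.
Proof. by rewrite mulr_gt0 ?prod_beta_gt0//; have [] := adm. Qed.

Lemma game_radiusS n : rho n.+1 = beta n * rho n.
Proof. by rewrite /game_radius big_ord_recr/= mulrAC mulrC mulrA. Qed.

Lemma game_radius_cvg0 : rho n @[n --> \oo] --> (0 : R).
Proof.
have geo : geometric rho0 (2^-1 : R) @ \oo --> (0 : R).
  by apply: cvg_geometric; rewrite ger0_norm ?invf_lt1 ?ltr1n.
apply: (squeeze_cvgr _ (@cvg_cst _ _ _ _ _) geo).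
apply: nearW => n; rewrite ltW ?game_radius_gt0//=.
elim: n => [|n IHn]; first by rewrite /game_radius big_ord0 expr0 mul1r mulr1.
rewrite game_radiusS exprSr mulrA [leRHS]mulrC.
by rewrite ler_pM// ?ltW ?beta_gt0 ?game_radius_gt0// beta_lt_half.
Qed.

Lemma game_radius_small (e : R) : 0 < e ->
  exists n0, forall n, (n0 <= n)%N -> rho n <= e.
Proof.
move=> e0; have /cvgrPdist_le/(_ e e0)[n0 _ n0P] := game_radius_cvg0.
exists n0 => n /n0P/=; rewrite sub0r normrN ger0_norm// ltW//.
exact: game_radius_gt0.
Qed.

Lemma geometric_tail (v : nat -> R) (n0 : nat) :
  (forall n, (n0 <= n)%N -> v n.+1 <= v n / 2) ->
  exists B : R, forall n, (n0 <= n)%N -> v n <= B * 2^-1 ^+ n.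
Proof.
move=> vS; exists (v n0 * 2 ^+ n0) => n /subnKC <-.
elim: (n - n0)%N => [|k IHk].
  by rewrite addn0 -mulrA -exprMn mulfV ?pnatr_eq0// expr1n mulr1.
rewrite addnS; apply: le_trans (vS _ (leq_addr _ _)) _.
by rewrite exprSr mulrA ler_pM2r ?invr_gt0.
Qed.

(** The weight allowed to a path of length [N] is a power of the product of
    [N + 1] ratios, while its ball only has the product of [N] of them as its
    radius; admissibility makes the extra ratio harmless.  Constants to the
    power [N] are harmless because the ratios tend to [0]. *)
Lemma path_cost_geometric (delta s a C : R) :
  0 <= delta -> 1 < a -> delta * (a * a) < s -> 0 < C ->
  exists B : R, exists n0 : nat, forall N, (n0 <= N)%N ->
    C ^+ N * ((P N.+1) `^ delta)^-1 `^ a * (2 * (rho N / 4)) `^ s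
      <= B * 2^-1 ^+ N.
Proof.
move=> delta0 a1 das C0; have [rho00 _ beta0 beta_adm] := adm.
pose kappa := s - delta * (a * a).
have kappa0 : 0 < kappa by rewrite subr_gt0.
have s0 : 0 <= s by rewrite (le_trans _ (ltW das))// !mulr_ge0//; lra.
have a10 : 0 < a - 1 by rewrite subr_gt0.
have [n1 n1P] := beta_adm (a - 1) a10.
pose v N := C ^+ N * (P N) `^ kappa * rho0 `^ s.
have tiny : 0 < (2 * C)^-1 `^ kappa^-1 by rewrite powR_gt0 ?invr_gt0 ?mulr_gt0.
have /cvgrPdist_le/(_ _ tiny)[n2 _ n2P] := beta0.
have [|B BP] := @geometric_tail v n2.
  move=> n /n2P/=; rewrite sub0r normrN gtr0_norm ?beta_gt0// => bn.
  have {}bn : beta n `^ kappa <= (2 * C)^-1.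
    have -> : (2 * C)^-1 = (2 * C)^-1 `^ kappa^-1 `^ kappa.
      by rewrite -powRrM mulVf ?gt_eqF// powRr1 ?invr_ge0 ?mulr_ge0 ?(ltW C0).
    apply: ge0_ler_powR => //; rewrite ?(ltW kappa0) ?nnegrE ?powR_ge0//.
    by rewrite ltW ?beta_gt0.
  rewrite /v big_ord_recr/= powRM ?(ltW (prod_beta_gt0 _)) ?(ltW (beta_gt0 _))//
    exprSr.
  rewrite [leLHS](_ : _ =
    C ^+ n * P n `^ kappa * rho0 `^ s * (C * beta n `^ kappa)); last by ring.
  rewrite ler_wpM2l ?mulr_ge0 ?exprn_ge0 ?powR_ge0 ?(ltW C0)//.
  apply: (le_trans (ler_wpM2l (ltW C0) bn)).
  by rewrite invfM mulrCA mulfV ?mulr1 ?gt_eqF.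
exists B; exists (maxn n1 n2) => N; rewrite geq_max => /andP[n1N n2N].
apply: le_trans (BP _ n2N); rewrite /v -!mulrA ler_wpM2l ?exprn_ge0 ?(ltW C0)//.
have PN := prod_beta_gt0 N.
have PNS : (P N) `^ a <= P N.+1.
  rewrite big_ord_recr/= -[a](subrK 1) addrC powRD ?(gt_eqF PN) ?implybT//.
  rewrite powRr1 ?(ltW PN)// ler_wpM2l ?(ltW PN)//.
  by rewrite -prod_powR_beta n1P.
have -> : P N `^ kappa = (P N `^ a `^ delta)^-1 `^ a * P N `^ s.
  rewrite -!powRrM -powRN -powRrM -powRD ?(gt_eqF PN) ?implybT//.
  by congr powR; rewrite /kappa; ring.
rewrite -mulrA; apply: ler_pM; rewrite ?powR_ge0//.
  apply: ge0_ler_powR; rewrite ?nnegrE ?invr_ge0 ?powR_ge0//; first lra.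
  rewrite lef_pV2 ?posrE ?powR_gt0 ?prod_beta_gt0//.
  by apply: ge0_ler_powR; rewrite ?nnegrE ?powR_ge0 ?(ltW (prod_beta_gt0 _)).
rewrite -powRM ?(ltW PN) ?(ltW rho00)//.
have : 0 < P N * rho0 by rewrite mulr_gt0.
rewrite !mulrA => rhoN.
by apply: ge0_ler_powR; rewrite ?nnegrE; [exact: s0|lra|lra|lra].
Qed.

End AdmissibleParameters.

(** * The game against a winning strategy of player II *)

Section Game.
Context (R : realType) (d : nat) (A : set 'rV[R]_d) (delta rho0 : R).
Context (beta : nat -> R) (tau : seq {fset 'rV[rat]_d} -> 'rV[rat]_d).
Hypothesis d0 : (0 < d)%N.
Hypothesis adm : admissible rho0 beta.
Hypothesis tau_wins : winning_strategyII A delta rho0 beta tau.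
Local Notation rho := (game_radius rho0 beta).
Local Notation history := (seq {fset 'rV[rat]_d}).
Implicit Types (h : history) (F : nat -> {fset 'rV[rat]_d}) (x : 'rV[R]_d).

Definition answers F (n : nat) : 'rV[rat]_d := tau (mkseq F n.+1).

Definition legal_history h : Prop :=
  forall n, (n < size h)%N ->
    legalI rho0 beta (nth fset0 h) (answers (nth fset0 h)) n.

Lemma legalI_local F F' n : (forall m, (m <= n)%N -> F m = F' m) ->
  legalI rho0 beta F (answers F) n -> legalI rho0 beta F' (answers F') n.
Proof.
move=> FF' [F0 Fsep Fball]; split; rewrite -?FF'// => m nm q qF.
have -> : answers F' m = answers F m.
  congr tau; apply/eq_in_map => i; rewrite mem_iota/= add0n => im.
  by rewrite FF'// nm (leq_trans (ltnSE im)).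
exact: Fball.
Qed.

(** Extended by illegal empty moves, a legal history is a run that II wins by
    obeying the rules at least as long as I does. *)
Lemma answer_in_last_move h : legal_history h -> (0 < size h)%N ->
  tau h \in last fset0 h.
Proof.
move=> hlegal h0; have hs : (size h).-1.+1 = size h by rewrite prednK.
have : legalII (nth fset0 h) (answers (nth fset0 h)) (size h).-1.
  have [[n nbad nP]|[allP _]] := tau_wins (nth fset0 h).
    have hn : (size h <= n)%N.
      by rewrite leqNgt; apply/negP => /hlegal.
    by have [] := nP (size h).-1; rewrite ?hs.
  by have [] := allP (size h).-1.
by rewrite /legalII /answers hs mkseq_nth nth_last.
Qed.

Lemma legal_history_rcons h n (F : {fset 'rV[rat]_d}) :
  legal_history h -> size h = n.+1 -> F != fset0 ->
  rat_separated (3 * rho n.+1) F ->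
  (forall q, q \in F ->
     eball (rat_point R (tau h)) ((1 - beta n) * rho n) (rat_point R q)) ->
  legal_history (rcons h F).
Proof.
move=> hlegal hn F0 Fsep Fball m; rewrite size_rcons ltnS leq_eqVlt.
case/predU1P => [->|mh]; last first.
  apply: legalI_local (hlegal m mh) => i im.
  by rewrite nth_rcons (leq_ltn_trans im).
have lastE : nth fset0 (rcons h F) (size h) = F by rewrite nth_rcons ltnn eqxx.
split; rewrite ?lastE ?hn// => _ [<-] q qF.
rewrite (_ : answers _ n = tau h); first exact: Fball.
congr tau; rewrite -[RHS](mkseq_nth fset0) hn.
apply/eq_in_map => i; rewrite mem_iota/= add0n -hn => ih.
by rewrite nth_rcons ih.
Qed.

Definition near_answer (r : R) h x : Prop := eball (rat_point R (tau h)) r x.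

Definition moves_reach_all h (Gh : nat -> {fset 'rV[rat]_d}) : Prop :=
  forall n, legal_history h -> size h = n.+1 ->
  forall x, near_answer (rho n / 4) h x ->
  exists k, [/\ legal_history (rcons h (Gh k)),
                (k < ncolours d * #|` Gh k|)%N &
                near_answer (rho n.+1 / 4) (rcons h (Gh k)) x].

(** Against a fixed history, [tau] is a function of the next move alone, to
    which [answer_family] applies. *)
Lemma exists_moves : exists G : history -> nat -> {fset 'rV[rat]_d},
  forall h, moves_reach_all h (G h).
Proof.
suff /choice[G GP] h : exists Gh, moves_reach_all h Gh by exists G.
have [hlegal|] := pselect (legal_history h); last by exists (fun=> fset0).
have [/size0nil ->|h0] := posnP (size h); first by exists (fun=> fset0).
set n := (size h).-1; have hn : size h = n.+1 by rewrite prednK.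
have [|G GP] := @answer_family R d (fun E => tau (rcons h E)) (tau h) (rho n)
    (beta n) d0 (game_radius_gt0 adm n) (beta_gt0 adm n) (beta_lt_half adm n).
  move=> E [E0 Esep Eball].
  rewrite -[E in _ \in E](last_rcons fset0 h E).
  apply: answer_in_last_move; last by rewrite size_rcons.
  by apply: (legal_history_rcons hlegal hn) => //; rewrite game_radiusS.
exists G => m _; rewrite hn => -[<-] x /GP[k [[G0 Gsep Gball] kG xG]].
exists k; split=> //; last by rewrite /near_answer game_radiusS.
by apply: (legal_history_rcons hlegal hn) => //; rewrite game_radiusS.
Qed.

Lemma legal_opening (q : 'rV[rat]_d) : legal_history [:: [fset q]%fset].
Proof.
case=> // _; split=> //=; first by apply/fset0Pn; exists q; rewrite inE.
by move=> p p'; rewrite !inE => /eqP -> /eqP ->; rewrite eqxx.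
Qed.

Lemma answer_opening (q : 'rV[rat]_d) : tau [:: [fset q]%fset] = q.
Proof.
have := answer_in_last_move (@legal_opening q) isT.
by rewrite /= inE => /eqP.
Qed.

Lemma answers_cvg (y : nat -> 'rV[rat]_d) x :
  (forall n, eball (rat_point R (y n)) (rho n / 4) x) ->
  rat_point R (y n) @[n --> \oo] --> x.
Proof.
move=> yx; apply/cvgrPdist_le => e e0.
have [n0 n0P] := game_radius_small adm e0.
exists n0 => // n /n0P rhoe /=.
rewrite [leLHS]/Num.Def.normr/= mx_normrE; apply: bigmax_le; first exact: ltW.
move=> [i j] _; rewrite (ord1 i)/=; apply: (le_trans (coord_le_enorm _ j)).
apply: (le_trans (yx n)); have := game_radius_gt0 adm n; lra.
Qed.

Lemma not_growth_rule F N0 : ~ growth_rule delta beta F ->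
  exists2 n, (N0 <= n)%N &
    1 < (\prod_(i < n) (#|` F i|%:R : R)^-1) / (\prod_(i < n) beta i `^ delta).
Proof.
move=> slow; apply: contrapT => fast; apply: slow; exists 1 => //.
apply: (@le_trans _ _ (ereal_sup [set (\prod_(i < n) (#|` F i|%:R : R)^-1 /
     \prod_(i < n) beta i `^ delta)%:E | n in [set n | (N0 <= n)%N]])).
  apply: ereal_inf_lbound; exists [set n | (N0 <= n)%N] => //.
  by exists N0.
apply: ge_ereal_sup => _ [n Nn <-]; rewrite lee_fin leNgt; apply/negP => n1.
by apply: fast; exists n.
Qed.

(** A point of [A] near the opening move is the limit of a run along the moves
    of [G].  Player II wins that run although the limit is in [A], so I must
    have played too few points, for infinitely many lengths. *)
Lemma few_points_infinitely_often (G : history -> nat -> {fset 'rV[rat]_d})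
    (q : 'rV[rat]_d) x N0 :
  (forall h, moves_reach_all h (G h)) ->
  A x -> eball (rat_point R q) (rho 0 / 4) x ->
  exists2 N, (N0 <= N)%N &
    path_balls (fun h k => rcons h (G h k)) (fun h => rat_point R (tau h))
      (ncolours d) (rho N / 4) N [:: [fset q]%fset]
      ((\prod_(i < N.+1) beta i) `^ delta)^-1 x.
Proof.
move=> GP Ax qx; pose step h k := rcons h (G h k).
pose fits h n :=
  [/\ size h = n.+1, legal_history h & near_answer (rho n / 4) h x].
have /choice[kk kkP] h : exists k, forall n, fits h n ->
    fits (step h k) n.+1 /\ (k < ncolours d * #|` G h k|)%N.
  have [[n [hn hl hx]]|none] := pselect (exists n, fits h n); last first.
    by exists 0%N => n hn; case: none; exists n.
  have [k [kl kG kx]] := GP h n hl hn x hx; exists k => m [].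
  by rewrite hn => -[<-] _ _; split=> //; split=> //; rewrite size_rcons hn.
pose run := fix run n : history :=
  if n is n'.+1 then step (run n') (kk (run n')) else [:: [fset q]%fset].
have runP n : fits (run n) n.
  elim: n => [|n /kkP[]//]; split=> //; first exact: legal_opening.
  by rewrite /near_answer answer_opening.
pose F n := last fset0 (run n).
have runE n : mkseq F n.+1 = run n.
  elim: n => [|n IHn]; first by [].
  by rewrite mkseqS IHn {1}/F/= last_rcons.
have Fx n : eball (rat_point R (answers F n)) (rho n / 4) x.
  by rewrite /answers runE; have [] := runP n.
have Flegal n : legalI rho0 beta F (answers F) n.
  have [rn rl _] := runP n; apply: legalI_local (rl n _) => [m mn|].
    by rewrite -runE nth_mkseq.
  by rewrite rn.
have slow : ~ growth_rule delta beta F.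
  have [[n []//]|[_ [//|]]] := tau_wins F.
  by case; exists x => //; exact: answers_cvg Fx.
have [[//|N] N0N] := not_growth_rule N0.+1 slow.
rewrite ltnS in N0N.
have PN := prod_beta_gt0 adm N.+1.
rewrite (prod_powR_beta adm) ltr_pdivlMr ?powR_gt0// mul1r prodfV => few.
exists N => //; exists (mkseq (fun i => kk (run i)) N).
have foldE n :
    foldl step [:: [fset q]%fset] (mkseq (fun i => kk (run i)) n) = run n.
  by elim: n => // n IHn; rewrite mkseqS foldl_rcons IHn.
split; first by rewrite size_mkseq.
  apply: (@le_trans _ _ (\prod_(i < N.+1) #|` F i|%:R)).
    rewrite big_ord_recl {1}/F/= cardfs1 mul1r /path_weight big_map.
    rewrite (_ : iota 0 N = index_iota 0 N) ?big_mkord; last first.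
      by rewrite /index_iota subn0.
    apply: ler_prod => i _.
    rewrite divr_ge0//= ler_pdivrMr ?ltr0n ?ncolours_gt0// -natrM ler_nat mulnC.
    by rewrite /F/= last_rcons; have [] := kkP _ _ (runP i).
  rewrite -[leLHS]invrK lef_pV2 ?posrE ?powR_gt0//; first exact: ltW.
  by rewrite invr_gt0 -invr_gt0; apply: lt_trans few; exact: powR_gt0.
by rewrite foldE; have [] := runP N.
Qed.

End Game.

(** * Null covers *)

Section NullCovers.
Context (R : realType) (d : nat).
Implicit Types (s eps : R) (X : set 'rV[R]_d).

(** The Borel-Cantelli argument: [X] is covered by each tail of a sequence whose
    contents have a finite sum. *)
Lemma hcontent_limsup_null s eps X (U : nat -> set 'rV[R]_d) (B : R) n0 :
  (forall N0, X `<=` \bigcup_(N in [set N | (N0 <= N)%N]) U N) ->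
  (forall N, (n0 <= N)%N -> (hcontent s eps (U N) <= (B * 2^-1 ^+ N)%:E)%E) ->
  hcontent s eps X = 0%E.
Proof.
move=> XU UB; apply/eqP; rewrite eq_le hcontent_ge0 andbT.
have BN N : (n0 <= N)%N -> 0 <= B * 2^-1 ^+ N.
  by move=> /UB; rewrite -lee_fin; exact/le_trans/hcontent_ge0.
have B0 : 0 <= B.
  by have := BN n0 (leqnn _); rewrite pmulr_lge0// exprn_gt0// invr_gt0.
have tail N0 : (n0 <= N0)%N ->
    (hcontent s eps X <= (2 * B * 2^-1 ^+ N0)%:E)%E.
  move=> nN0; apply: (le_trans (@hcontent_bigcup _ _ s eps X
      (fun j => U (N0 + j)%N) _)).
    by move=> x /(XU N0)[N /= N0N UN]; exists (N - N0)%N => //=; rewrite subnKC.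
  apply: (@le_trans _ _ (\sum_(j <oo) (B * 2^-1 ^+ (N0 + j))%:E)%E).
    apply: lee_nneseries => j *; first exact: hcontent_ge0.
    by apply: UB; rewrite (leq_trans nN0)// leq_addr.
  apply: nneseries_le => [j|n].
    by rewrite BN// (leq_trans nN0)// leq_addr.
  suff -> : \sum_(j < n) B * 2^-1 ^+ (N0 + j)
      = 2 * B * 2^-1 ^+ N0 - 2 * B * 2^-1 ^+ (N0 + n).
    by rewrite gerBl !mulr_ge0// exprn_ge0// invr_ge0.
  elim: n => [|n IHn]; first by rewrite big_ord0 addn0 subrr.
  by rewrite big_ord_recr IHn/= addnS exprS; field.
have geo : geometric (2 * B) (2^-1 : R) @ \oo --> (0 : R).
  by apply: cvg_geometric; rewrite ger0_norm ?invf_lt1 ?ltr1n.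
apply/lee_addgt0Pr => e e0; rewrite add0e.
have /cvgrPdist_le/(_ e e0)[n1 _ /(_ (maxn n0 n1))] := geo.
rewrite /= leq_maxr sub0r normrN => /(_ isT) small.
apply: (le_trans (tail (maxn n0 n1) (leq_maxl _ _))).
by rewrite lee_fin (le_trans _ small)// ler_norm.
Qed.

Lemma hcontent_countable_null s eps (I : countType) X
    (U : I -> set 'rV[R]_d) :
  X `<=` \bigcup_i U i -> (forall i, hcontent s eps (U i) = 0%E) ->
  hcontent s eps X = 0%E.
Proof.
move=> XU U0; apply/eqP; rewrite eq_le hcontent_ge0 andbT.
pose V n := oapp U set0 (@choice.unpickle I n).
apply: (le_trans (@hcontent_bigcup _ _ s eps X V _)).
  move=> x /XU[i _ Uix]; exists (choice.pickle i) => //.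
  by rewrite /V choice.pickleK.
rewrite eseries0// => n _ _; rewrite /V.
by case: choice.unpickle => [i|]; [exact: U0|exact: hcontent0].
Qed.

End NullCovers.

Theorem theorem3 (R : realType) (d : nat) (A : set 'rV[R]_d)
    (delta rho0 : R) (beta : nat -> R) :
  (1 <= d)%N ->
  0 < delta -> delta <= d%:R ->
  admissible rho0 beta ->
  (exists tau : seq {fset 'rV[rat]_d} -> 'rV[rat]_d,
     winning_strategyII A delta rho0 beta tau) ->
  (hausdorff_dim A <= delta%:E)%E.
Proof.
move=> d0 delta0 _ adm [tau tau_wins].
apply: hausdorff_dim_le; first exact: ltW.
move=> s eps delta_s eps0.
(* Two factors [a] are lost: one to the count of paths, one to [beta_N]. *)
have [a a1 das] : exists2 a : R, 1 < a & delta * (a * a) < s.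
  pose e := Num.min 1 ((s - delta) / (4 * delta)).
  have e0 : 0 < e by rewrite lt_min ltr01 divr_gt0 ?subr_gt0 ?mulr_gt0.
  have e1 : e <= 1 by rewrite ge_min lexx.
  have ed : e * (4 * delta) <= s - delta.
    by rewrite -ler_pdivlMr ?mulr_gt0// ge_min lexx orbT.
  have ee : delta * (e * e) <= delta * e.
    by rewrite ler_wpM2l ?(ltW delta0)// ger_pMr.
  have de : 0 < delta * e by exact: mulr_gt0.
  by exists (1 + e); [lra|nra].
have K0 := ncolours_gt0 d; set K := ncolours d in K0.
have [G GP] := exists_moves d0 adm tau_wins.
(* A label [k] only guarantees [(k + 1) / K] points, whence the factor [K^a]. *)
have [C C0 CP] := pseries_bounded a1.
have KC n : \sum_(k < n) (K%:R / k.+1%:R : R) `^ a <= K%:R `^ a * C.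
  under eq_bigr do rewrite powRM ?invr_ge0// -powR_inv1// -powRrM mulN1r.
  by rewrite -mulr_sumr ler_wpM2l ?powR_ge0.
have KC0 : 0 < K%:R `^ a * C by rewrite mulr_gt0 ?powR_gt0 ?ltr0n.
have [B [n0 BP]] := path_cost_geometric adm (ltW delta0) a1 das KC0.
have [n1 n1P] := game_radius_small adm eps0.
pose near q := A `&` eball (rat_point R q) (game_radius rho0 beta 0 / 4).
apply: (@hcontent_countable_null _ _ s eps _ A near) => [x Ax|q].
  have [|q qx] := @rat_point_dense R d x (game_radius rho0 beta 0 / 4).
    by rewrite divr_gt0 ?game_radius_gt0.
  by exists q.
pose U N := path_balls (fun h k => rcons h (G h k))
  (fun h => rat_point R (tau h)) K (game_radius rho0 beta N / 4) N
  [:: [fset q]%fset] ((\prod_(i < N.+1) beta i) `^ delta)^-1.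
apply: (@hcontent_limsup_null _ _ s eps _ U B (maxn n0 n1)) => [N0 x [Ax qx]|N].
  have [N N0N xN] := few_points_infinitely_often adm tau_wins N0 GP Ax qx.
  by exists N.
rewrite geq_max => /andP[n0N n1N].
have rhoN := game_radius_gt0 adm N.
have UN : (hcontent s eps (U N) <= ((K%:R `^ a * C) ^+ N
    * ((\prod_(i < N.+1) beta i) `^ delta)^-1 `^ a
    * (2 * (game_radius rho0 beta N / 4)) `^ s)%:E)%E.
  apply: hcontent_path_balls => //; try lra.
    by have := n1P N n1N; lra.
  by rewrite invr_gt0 powR_gt0 ?(prod_beta_gt0 adm).
by apply: (le_trans UN); rewrite lee_fin BP.
Qed.
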